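(* Let $n,k$ be integers with $1\le k\le n-1$, let $r_1\ge\cdots\ge r_n\ge0$ be real numbers, let $R_0=\sum_{i=1}^n r_i>0$ and $r([k])=\sum_{i=1}^k r_i$. The value $V$ of the booby trap search game with $n$ boxes, rewards $r_1,\dots,r_n$ and $k$ booby traps on the complete hypergraph on $[n]$ satisfies $$V\ge\frac{R_0}{k+1}\left(1-\frac1{k+1}\right)^k\left(1-\frac{r([k])}{R_0}\right).$$
   Context: The booby trap search game: there are $n$ boxes, identified with the vertex set $[n]=\{1,\dots,n\}$ of a hypergraph $G$ with set of hyperedges $E\subseteq 2^{[n]}$. Box $i$ contains a reward $r_i$. A Hider pure strategy is a set $H\subseteq[n]$ with $|H|=k$ (the booby trapped boxes). A Searcher pure strategy is a hyperedge $S\in E$ (the boxes opened). The payoff (to the maximizing Searcher, in a zero-sum game against the minimizing Hider) is $R(S,H)=\sum_{i\in S}r_i$ if $S\cap H=\emptyset$, and $R(S,H)=0$ otherwise. Mixed strategies are probability distributions over pure strategies, and payoffs extend by expectation. The value is in the usual sense for finite two-person zero-sum games. In the complete hypergraph, $E=2^{[n]}$, so the Searcher may open any subset of $[n]$. *)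

(* Defs.v *)
From mathcomp Require Import all_boot all_order all_algebra.
From mathcomp Require Import all_classical all_reals.

Set Implicit Arguments.
Unset Strict Implicit.
Unset Printing Implicit Defensive.

Import Order.TTheory GRing.Theory Num.Theory.

Local Open Scope classical_set_scope.
Local Open Scope ring_scope.

Section ZeroSumGame.
Variables (R : realType) (A B : finType).

Definition mixed (T : finType) : set (T -> R) :=
  [set p | (forall x, 0 <= p x) /\ \sum_x p x = 1].
Arguments mixed : clear implicits.

Variable u : A -> B -> R.

Definition expected_payoff (p : A -> R) (q : B -> R) : R :=
  \sum_a \sum_b p a * q b * u a b.

(* The strategy sets are compact and nonempty whenever A and B are nonempty,
   so all the suprema and infima below are then finite and attained. *)
Definition maximin : R :=
  sup [set inf [set expected_payoff p q | q in mixed B] | p in mixed A].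

Definition minimax : R :=
  inf [set sup [set expected_payoff p q | p in mixed A] | q in mixed B].

(* The row player (strategies in A) maximizes, the column player minimizes. *)
Definition is_value (V : R) : Prop := maximin = V /\ minimax = V.

End ZeroSumGame.

Section BoobyTrap.
Variables (R : realType) (n k : nat).

Definition hider_pure := {H : {set 'I_n} | #|H| == k}.

Definition searcher_pure (E : {set {set 'I_n}}) := {S : {set 'I_n} | S \in E}.

(* Box i of {1, ..., n} is the ordinal i - 1 of 'I_n. *)
Definition payoff (r : 'I_n -> R) (E : {set {set 'I_n}})
    (S : searcher_pure E) (H : hider_pure) : R :=
  if [disjoint val S & val H] then \sum_(i in val S) r i else 0.

Definition is_booby_trap_value (r : 'I_n -> R) (E : {set {set 'I_n}})
    (V : R) : Prop := is_value (@payoff r E) V.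

Definition complete_hypergraph : {set {set 'I_n}} := [set: {set 'I_n}]%SET.

End BoobyTrap.

(* Main.v *)
Require Import Defs.
From mathcomp Require Import all_boot all_order all_algebra.
From mathcomp Require Import all_classical all_reals.
From mathcomp Require Import ring.

Import Order.TTheory GRing.Theory Num.Theory.
Local Open Scope ring_scope.

(** The Searcher opens each box independently with probability
    [p = 1 / (k + 1)]. Against a Hider set [H], a box outside [H] contributes
    its reward with probability [p (1 - p)^k], so the expected payoff is
    [p (1 - p)^k] times the total reward outside [H], which is least when [H]
    consists of the [k] most valuable boxes. *)

Section Game.
Variables (R : realType) (A B : finType) (u : A -> B -> R).

Lemma mixed_le1 (T : finType) (p : T -> R) x : mixed p -> p x <= 1.
Proof.
by case=> p_ge0 <-; rewrite (bigD1 x) //= lerDl sumr_ge0.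
Qed.

Lemma mixed_pure (T : finType) (x : T) :
  mixed (fun y => (y == x)%:R : R).
Proof.
split=> [y|]; first exact: ler0n.
by rewrite (bigD1 x) //= eqxx big1 ?addr0 // => y /negPf ->.
Qed.

(** This bound is uniform in both mixed strategies. It supplies the boundedness without which [inf]
    and [sup] carry no order information. *)
Lemma normr_expected_payoff_le {p : A -> R} {q : B -> R} :
  mixed p -> mixed q ->
  `|expected_payoff u p q| <= \sum_a \sum_b `|u a b|.
Proof.
move=> mp mq; apply: le_trans (ler_norm_sum _ _ _) _; apply: ler_sum => a _.
apply: le_trans (ler_norm_sum _ _ _) _; apply: ler_sum => b _.
have [p0 _] := mp; have [q0 _] := mq.
rewrite 2!normrM (ger0_norm (p0 a)) (ger0_norm (q0 b)).
by rewrite ler_piMl // mulr_ile1 // mixed_le1.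
Qed.

(** Against a mixed [q], the payoff of [p] is a [q]-average of its payoffs against pure columns, so
    a bound for pure columns suffices. The column [b0] witnesses that the column player has a
    strategy. *)
Lemma maximin_ge (b0 : B) (p : A -> R) (c : R) : mixed p ->
  (forall b, c <= \sum_a p a * u a b) -> c <= maximin u.
Proof.
move=> mp cle; set M := \sum_a \sum_b `|u a b|.
have has_q : mixed (fun y => (y == b0)%:R : R) := mixed_pure B b0.
apply: (@le_trans _ _
    (inf [set expected_payoff u p q | q in mixed (T:=B)]%classic)).
  apply: lb_le_inf.
    by exists (expected_payoff u p (fun y => (y == b0)%:R)), (fun y => (y == b0)%:R).
  move=> _ [q [q_ge0 q1] <-]; rewrite /expected_payoff exchange_big /=.
  rewrite -[c]mul1r -q1 mulr_suml; apply: ler_sum => b _.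
  under eq_bigr do rewrite mulrAC mulrC.
  by rewrite -mulr_sumr ler_wpM2l.
apply: ub_le_sup; last by exists p.
(* The outer set is bounded above: each infimum is at most the payoff against the pure strategy
   [b0], hence at most [M]. *)
exists M => _ [p' mp' <-].
apply: (@le_trans _ _ (expected_payoff u p' (fun y => (y == b0)%:R))).
  apply: ge_inf; last by exists (fun y => (y == b0)%:R).
  exists (- M) => _ [q mq <-].
  by have := normr_expected_payoff_le mp' mq; rewrite ler_norml => /andP[].
exact: le_trans (ler_norm _) (normr_expected_payoff_le mp' has_q).
Qed.

End Game.

Section RandomSubset.
Context {R : comPzRingType} {I : finType} (p : R).

Definition subset_weight (S : {set I}) : R :=
  \prod_i (if i \in S then p else 1 - p).

Lemma sum_subset_weight : \sum_S subset_weight S = 1.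
Proof.
rewrite -(bigA_distr _ _ (fun=> p) (fun=> 1 - p)) /=.
by rewrite big1 // => i _; rewrite addrC subrK.
Qed.

Lemma sum_subset_weight_mem_disjoint (H : {set I}) i : i \notin H ->
  \sum_(S : {set I} | (i \in S) && [disjoint S & H]) subset_weight S
    = p * (1 - p) ^+ #|H|.
Proof.
(* The zeros of [f] on [H] and of [g] at [i] kill the product unless [S] contains [i] and avoids
   [H]. The unrestricted sum then factors into the [f j + g j], equal to [p] at [i], [1 - p] on [H]
   and [1] elsewhere. *)
move=> iH; pose f j := if j \in H then 0 else p.
pose g j := if j == i then 0 else 1 - p.
transitivity (\sum_(S : {set I}) \prod_j (if j \in S then f j else g j)).
  rewrite big_mkcond; apply: eq_bigr => S _; case: ifP => [/andP[iS dSH]|].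
    apply: eq_bigr => j _; rewrite /f /g; case: ifP => jS.
      by rewrite (disjointFr dSH jS).
    by case: eqP jS => // ->; rewrite iS.
  move=> /negbT; rewrite negb_and => /orP[iS|].
    by rewrite (bigD1 i) //= (negPf iS) /g eqxx mul0r.
  rewrite -setI_eq0 => /set0Pn[j /setIP[jS jH]].
  by rewrite (bigD1 j) //= jS /f jH mul0r.
rewrite -bigA_distr /= (bigD1 i) //= /f /g (negPf iH) eqxx addr0.
congr (_ * _); rewrite -prodr_const big_mkcond [RHS]big_mkcond /=.
apply: eq_bigr => j _; have [->|ji] /= := eqVneq j i; first by rewrite (negPf iH).
by case: ifP => _; rewrite ?add0r // addrC subrK.
Qed.

(** By linearity, each box contributes its reward times the weight of the sets that contain it and
    avoid [H]; no such set exists for a box in [H]. *)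
Lemma expected_reward_disjoint (r : I -> R) (H : {set I}) :
  \sum_(S : {set I}) subset_weight S *
      (if [disjoint S & H] then \sum_(i in S) r i else 0)
    = p * (1 - p) ^+ #|H| * \sum_(i | i \notin H) r i.
Proof.
transitivity (\sum_i \sum_(S : {set I} | (i \in S) && [disjoint S & H])
                subset_weight S * r i).
  rewrite (exchange_big_dep xpredT) //=; apply: eq_bigr => S _.
  case: ifP => dSH; last by rewrite mulr0 big1 // => i; rewrite andbF.
  by rewrite mulr_sumr; apply: eq_bigl => i; rewrite andbT.
rewrite mulr_sumr [RHS]big_mkcond /=; apply: eq_bigr => i _.
case: ifP => iH; first by rewrite -mulr_suml sum_subset_weight_mem_disjoint.
rewrite big1 // => S /andP[iS dSH].
by rewrite (disjointFr dSH iS) in iH.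
Qed.

End RandomSubset.

(** Subtracting [t] from every term changes both sums equally, as the sets have the same size.
    Afterwards [T] collects only nonnegative terms and misses only nonpositive ones. *)
Lemma ler_sum_threshold (R : realDomainType) (I : finType) (r : I -> R) (t : R)
    (H T : {set I}) : #|H| = #|T| ->
  (forall i, i \in T -> t <= r i) -> (forall i, i \notin T -> r i <= t) ->
  \sum_(i in H) r i <= \sum_(i in T) r i.
Proof.
move=> eHT ger ler.
have shift (X : {set I}) :
    \sum_(i in X) r i = \sum_(i in X) (r i - t) + t *+ #|X|.
  by rewrite big_split /= sumr_const mulNrn subrK.
rewrite !shift eHT lerD2r big_mkcond [leRHS]big_mkcond /=.
apply: ler_sum => i _; case: (boolP (i \in T)) => iT.
  by case: ifP => // _; rewrite subr_ge0 ger.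
by case: ifP => // _; rewrite subr_le0 ler.
Qed.

Lemma card_ord_ltn n k : (k <= n)%N -> #|[set i : 'I_n | (i < k)%N]| = k.
Proof.
by move=> kn; rewrite cardsE -sum1_card (big_ord_narrow kn) /= sum1_card card_ord.
Qed.

Lemma sum_le_sum_first (R : realDomainType) n k (r : 'I_n -> R) (H : {set 'I_n}) :
  (forall i j : 'I_n, (i <= j)%N -> r j <= r i) -> #|H| = k ->
  \sum_(i in H) r i <= \sum_(i < n | (i < k)%N) r i.
Proof.
move=> r_noninc cH.
have kn : (k <= n)%N by rewrite -cH -[leqRHS]card_ord max_card.
case: k => [|k] in cH kn *.
  by rewrite (cards0_eq cH) big_set0 big_pred0.
have -> : \sum_(i < n | (i < k.+1)%N) r i
        = \sum_(i in [set i : 'I_n | (i < k.+1)%N]) r i.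
  by apply: eq_bigl => i; rewrite inE.
(* The threshold is the reward of the last of the first [k.+1] boxes, which has index [k]; the empty
   case was split off because it has no such box. *)
apply: (@ler_sum_threshold _ _ _ (r (Ordinal kn))).
- by rewrite card_ord_ltn.
- by move=> i; rewrite inE ltnS => ik; apply: r_noninc.
- by move=> i; rewrite inE -leqNgt => ki; apply: r_noninc; apply: ltnW.
Qed.

Theorem proposition13 (R : realType) (n k : nat) (r : 'I_n -> R) (V : R)
    (hk : (1 <= k <= n - 1)%N)
    (r_noninc : forall i j : 'I_n, (i <= j)%N -> r j <= r i)
    (r_ge0 : forall i : 'I_n, 0 <= r i)
    (R0_gt0 : 0 < \sum_(i < n) r i)
    (hV : is_booby_trap_value k r (complete_hypergraph n) V) :
  let R0 := \sum_(i < n) r i in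
  let rk := \sum_(i < n | (i < k)%N) r i in
  R0 / k.+1%:R * (1 - 1 / k.+1%:R) ^+ k * (1 - rk / R0) <= V.
Proof.
cbv zeta; set R0 := \sum_(i < n) r i; set rk := \sum_(i < n | _) r i.
case: hV => <- _; rewrite div1r; set p : R := k.+1%:R^-1.
have p_ge0 : 0 <= p by rewrite invr_ge0.
have q_ge0 : 0 <= 1 - p by rewrite subr_ge0 invf_le1 ?ler1n ?ltr0n.
have kn : (k <= n)%N by case/andP: hk => _ /leq_trans; apply; apply: leq_subr.
(* Every set is a hyperedge, so sums over Searcher strategies reindex to sums over all subsets. *)
pose edge (S : {set 'I_n}) : searcher_pure (complete_hypergraph n) :=
  exist _ S (finset.in_setT S).
have sum_edge (f : searcher_pure (complete_hypergraph n) -> R) :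
    \sum_a f a = \sum_S f (edge S).
  by apply: reindex; exists val => a _ //; apply: val_inj.
have H0 : hider_pure n k.
  by exists [set i : 'I_n | (i < k)%N]; rewrite card_ord_ltn.
apply: (@maximin_ge _ _ _ _ H0 (fun a => subset_weight p (val a))).
  split=> [a|]; last by rewrite sum_edge sum_subset_weight.
  by apply: prodr_ge0 => i _; case: ifP.
move=> [H cH]; rewrite sum_edge /payoff /= expected_reward_disjoint (eqP cH).
have -> : R0 * p * (1 - p) ^+ k * (1 - rk / R0) = p * (1 - p) ^+ k * (R0 - rk).
  by field; rewrite gt_eqF.
(* Splitting [R0] along [H] cancels the reward outside [H] and leaves the comparison of [H] with the
   first [k] boxes. *)
rewrite ler_wpM2l ?mulr_ge0 ?exprn_ge0 // lerBlDr /R0 (bigID (mem H)) /= addrC.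
by rewrite lerD2l; exact: sum_le_sum_first (eqP cH).
Qed.
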